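(* Let $\lambda,\mu$ be partitions with $D(\mu)\subset D(\lambda)$, let $N$ be a positive integer, let $\boldsymbol s=(s_{ij})\in T^{\mathrm{diag}}(\lambda/\mu,\mathbb C)$, i.e. $s_{ij}=a_{j-i}$ for a family $(a_c)_{c\in\mathbb Z}$ of complex numbers, and let $(\theta_1,\ldots,\theta_n)$ be any outside decomposition of $\lambda/\mu$. Then \[ \zeta^{\mathrm{so},N}_{\lambda/\mu}(\boldsymbol s)=\det\left(\zeta^{\mathrm{so},N}_{\theta_i\#\theta_j}(\boldsymbol s_{\theta_i}\#\boldsymbol s_{\theta_j})\right)_{1\le i,j\le n}, \] where $\boldsymbol s_{\theta_i}\#\boldsymbol s_{\theta_j}$ is the filling of $\theta_i\#\theta_j$ having $a_c$ in its box of content $c$, and the $(i,j)$ entry is $1$ if $\theta_i\#\theta_j=\emptyset$ and $0$ if $\theta_i\#\theta_j$ is undefined.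
   Context: Diagrams. For a partition $\lambda=(\lambda_1,\ldots,\lambda_r)$, $D(\lambda)=\{(i,j): 1\le i\le r,\ 1\le j\le\lambda_i\}$ (row $i$ downwards, column $j$ to the right), and $D(\lambda/\mu)=D(\lambda)\setminus D(\mu)$. The content of box $(i,j)$ is $j-i$. $T^{\mathrm{diag}}(\lambda/\mu,\mathbb C)$ is the set of complex fillings of $D(\lambda/\mu)$ that are constant on diagonals of fixed content. Orthogonal functions. Let $[\overline N]^\infty=\{1<\overline1<2<\overline2<\cdots<N<\overline N<\infty\}$, with $|i|=i$, $|\overline i|=i^{-1}$, $|\infty|=1$. Let $E$ be a skew diagram, or a strip whose boxes carry prescribed contents. An so-tableau of shape $E$ is a filling of $E$ with letters of $[\overline N]^\infty$ such that: (SO1) entries are weakly increasing along each row (left to right); (SO2) entries are strictly increasing down each column; (SO3) each box of content $-i$ has entry $\ge i+1$ (vacuous for $-i\ge0$); (SO4) the entries equal to $\infty$ form a shape such that no two symbols $\infty$ appear in the same row. For $\boldsymbol s$ a complex filling of $E$, $\zeta_E^{\mathrm{so},N}(\boldsymbol s)=\sum_M\prod_{\alpha\in E}|m_\alpha|^{-s_\alpha}$, summed over all so-tableaux $M=(m_\alpha)$ of shape $E$; $\zeta^{\mathrm{so},N}_{\lambda/\mu}$ is the case $E=D(\lambda/\mu)$. Outside decompositions. A strip is an edgewise connected skew diagram containing no $2\times2$ block; its starting box is its bottommost-leftmost box and its ending box is its topmost-rightmost box. A box $(i,j)$ of a diagram is on its left (resp. right, top, bottom) perimeter if $(i,j-1)$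 (resp. $(i,j+1)$, $(i-1,j)$, $(i+1,j)$) is not in the diagram. An outside decomposition of $\lambda/\mu$ is an ordered set $(\theta_1,\ldots,\theta_n)$ of strips whose disjoint union is $D(\lambda/\mu)$, each having its starting box on the left or bottom perimeter of $D(\lambda/\mu)$ and its ending box on the right or top perimeter. Operation $\#$. A non-starting box of a strip is approached from the left (resp. from below) if the preceding box of the strip is immediately to its left (resp. below it). It is known that, for each content $c$, a direction $d(c)\in\{\text{left},\text{below}\}$ can be chosen so that every non-starting box of content $c$ in the strips is approached from direction $d(c)$, and every starting box of content $c$ is on the left perimeter if $d(c)=\text{left}$ and on the bottom perimeter if $d(c)=\text{below}$; if no box of $D(\lambda/\mu)$ has content $c$ then $d(c)$ is chosen arbitrarily. Fix such choices. For $p\le q$ let $R[p,q]$ be the strip with exactly one box of each content $p,p+1,\ldots,q$, where the box of content $c$ ($p<c\le q$) is immediately to the right of the box of content $c-1$ if $d(c)=\text{left}$ and immediately above it if $d(c)=\text{below}$. If $p_i$ and $q_i$ denote the contents of the starting and ending boxes of $\theta_i$ (so $\theta_i$ is a diagonal translate of $R[p_i,q_i]$), then $\theta_i\#\theta_j=R[p_j,q_i]$ if $p_j\le q_i$, $\theta_i\#\theta_j=\emptyset$ if $p_j=q_i+1$, and $\theta_i\#\theta_j$ is undefined if $p_j>q_i+1$. Boxes of $\theta_i\#\theta_j$ keep their contents $p_j,\ldots,q_i$.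
   Formalization: Condition (SO2) is corrected: entries increase strictly down columns except that ∞ may repeat in a column. With the literal (SO2) the identity fails, e.g. for λ=(2) cut into two single boxes, where the determinant exceeds the left side by 1. *)

(* Defs.v *)
From HB Require Import structures.
From mathcomp Require Import all_boot all_order all_algebra finmap.
From mathcomp Require Import reals sequences exp trigo complex.

Set Implicit Arguments.
Unset Strict Implicit.
Unset Printing Implicit Defensive.

Import Order.TTheory GRing.Theory Num.Theory.

Local Open Scope fset_scope.
Local Open Scope ring_scope.

(* Boxes (i, j): row i numbered downwards, column j numbered to the right.
   Coordinates are integers, so that diagonal translates of a strip are
   available even where they leave the positive quadrant.                     *)
Definition box : Type := (int * int)%type.

Definition content (b : box) : int := b.2 - b.1.

Definition left_of  (b : box) : box := (b.1, b.2 - 1).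
Definition right_of (b : box) : box := (b.1, b.2 + 1).
Definition above    (b : box) : box := (b.1 - 1, b.2).
Definition below    (b : box) : box := (b.1 + 1, b.2).

(* Trailing zero parts are allowed; they do not affect the diagram. *)
Definition is_partition (la : seq nat) : bool := sorted geq la.

Definition diagram (la : seq nat) : {fset box} :=
  [fset b in [seq (i%:Z, j%:Z) | i <- iota 1 (size la),
                                 j <- iota 1 (nth 0%N la i.-1)]].

Definition skew_diagram (la mu : seq nat) : {fset box} :=
  diagram la `\` diagram mu.

(* The alphabet 1 < 1bar < 2 < 2bar < ... < N < Nbar < infinity, encoded by the
   ranks 0 < 1 < ... < 2N: the letter i has rank 2(i-1), the letter ibar has
   rank 2(i-1)+1, and infinity has rank 2N.                                   *)
Definition letter (N : nat) : finType := 'I_(N.*2.+1).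

Definition is_infty N (m : letter N) : bool := m == ord_max.

(* The letter m is at least the unbarred letter k (k >= 1); infinity is at
   least every k, including k > N.                                            *)
Definition letter_ge N (m : letter N) (k : nat) : bool :=
  is_infty m || (k.-1.*2 <= m)%N.

Definition letter_abs (R : realType) N (m : letter N) : R :=
  if is_infty m then 1
  else if odd m then (m./2.+1)%:R^-1 else (m./2.+1)%:R.

Definition complex_exp (R : realType) (z : R[i]) : R[i] :=
  Complex (expR (complex.Re z) * cos (complex.Im z))
          (expR (complex.Re z) * sin (complex.Im z)).

(* t ^ z for a real t > 0 *)
Definition complex_pow (R : realType) (t : R) (z : R[i]) : R[i] :=
  complex_exp (real_complex R (ln t) * z).

(* The second clause exempts pairs of infinities: infinity may repeat in a
   column, though not in a row (last clause), so the infinities form a vertical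
   strip, as in Sundaram's odd orthogonal tableaux. Read literally, "entries are
   strictly increasing down each column" would also forbid two infinities in a
   column; the determinantal identity is then false, already for the shape (2)
   cut into two single boxes with the second one approached from below: the
   determinant exceeds the left-hand side by 1.                               *)
Definition so_tableau N (E : {fset box}) (M : {ffun E -> letter N}) : bool :=
  [&& [forall x : E, forall y : E,
         ((val x).1 == (val y).1) && ((val x).2 < (val y).2)
           ==> (M x <= M y)%N],
      [forall x : E, forall y : E,
         ((val x).2 == (val y).2) && ((val x).1 < (val y).1)
           ==> (M x < M y)%N || is_infty (M x) && is_infty (M y)],
      [forall x : E,
         (content (val x) <= 0)
           ==> letter_ge (M x) (`|content (val x)|%N).+1]
    & [forall x : E, forall y : E,
         [&& (val x).1 == (val y).1, is_infty (M x) & is_infty (M y)]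
           ==> (x == y)]].

Definition so_zeta (R : realType) N (E : {fset box}) (s : E -> R[i]) : R[i] :=
  \sum_(M : {ffun E -> letter N} | so_tableau M)
    \prod_(x : E) complex_pow (letter_abs R (M x)) (- s x).

Definition diag_filling (T : Type) (a : int -> T) (E : {fset box}) : E -> T :=
  fun x => a (content (val x)).

Definition adjacent (b c : box) : bool :=
  (`|b.1 - c.1| + `|b.2 - c.2| == 1)%N.

Definition edge_connected (E : {fset box}) : bool :=
  [forall x : E, forall y : E,
     connect (fun u v : E => adjacent (val u) (val v)) x y].

Definition has_2x2_block (E : {fset box}) : Prop :=
  exists b : box, [/\ b \in E, right_of b \in E, below b \in E
                    & right_of (below b) \in E].

Definition is_skew_diagram (E : {fset box}) : Prop :=
  exists la mu : seq nat,
    [/\ is_partition la, is_partition mu, diagram mu `<=` diagram la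
      & E = skew_diagram la mu].

Definition is_strip (E : {fset box}) : Prop :=
  [/\ E != fset0, is_skew_diagram E, edge_connected E & ~ has_2x2_block E].

Definition is_start (E : {fset box}) (b : box) : bool :=
  (b \in E) && all (fun x : box => (x.1 <= b.1) && (b.2 <= x.2)) E.

Definition is_end (E : {fset box}) (b : box) : bool :=
  (b \in E) && all (fun x : box => (b.1 <= x.1) && (x.2 <= b.2)) E.

(* On a strip there is exactly one candidate, so the default value is never
   used.                                                                      *)
Definition start_box (E : {fset box}) : box :=
  head (0, 0) [seq b <- E | is_start E b].

Definition end_box (E : {fset box}) : box :=
  head (0, 0) [seq b <- E | is_end E b].

Definition on_left (D : {fset box}) (b : box) : bool :=
  (b \in D) && (left_of b \notin D).
Definition on_right (D : {fset box}) (b : box) : bool :=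
  (b \in D) && (right_of b \notin D).
Definition on_top (D : {fset box}) (b : box) : bool :=
  (b \in D) && (above b \notin D).
Definition on_bottom (D : {fset box}) (b : box) : bool :=
  (b \in D) && (below b \notin D).

Definition outside_decomposition (D : {fset box}) n
    (theta : 'I_n -> {fset box}) : Prop :=
  [/\ forall k, is_strip (theta k),
      forall k l, k != l -> [disjoint theta k & theta l],
      forall b : box, b \in D <-> exists k, b \in theta k,
      forall k, on_left D (start_box (theta k)) || on_bottom D (start_box (theta k))
    & forall k, on_right D (end_box (theta k)) || on_top D (end_box (theta k))].

Inductive direction := FromLeft | FromBelow.

Definition predecessor (d : direction) (b : box) : box :=
  match d with FromLeft => left_of b | FromBelow => below b end.

Definition successor (d : direction) (b : box) : box :=
  match d with FromLeft => right_of b | FromBelow => above b end.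

(* Both left_of b and below b have content one less than b, and a strip has at
   most one box of each content: if one of them is in the strip, it is the box
   preceding b.                                                               *)
Definition approached_from (d : direction) (E : {fset box}) (b : box) : bool :=
  predecessor d b \in E.

Definition compatible_directions (D : {fset box}) n
    (theta : 'I_n -> {fset box}) (d : int -> direction) : Prop :=
  (forall k b, b \in theta k -> b != start_box (theta k) ->
     approached_from (d (content b)) (theta k) b) /\
  (forall k, let b := start_box (theta k) in
     match d (content b) with
     | FromLeft => on_left D b
     | FromBelow => on_bottom D b
     end).

(* R[p,q], placed so that the box at (i, j) has content j - i; its starting box
   is (0, p), and ribbon_box d p k is its box of content p + k.               *)
Fixpoint ribbon_box (d : int -> direction) (p : int) (k : nat) : box :=
  if k is k'.+1 then successor (d (p + k%:Z)) (ribbon_box d p k') else (0, p).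

Definition ribbon (d : int -> direction) (p q : int) : {fset box} :=
  [fset b in [seq ribbon_box d p k | k <- iota 0 (`|q - p|%N).+1]].

(* theta_i # theta_j, with None for "undefined" *)
Definition hash (d : int -> direction) (ti tj : {fset box}) :
    option {fset box} :=
  let p := content (start_box tj) in
  let q := content (end_box ti) in
  if p <= q then Some (ribbon d p q)
  else if p == q + 1 then Some fset0
  else None.

Definition hash_entry (R : realType) N (a : int -> R[i])
    (h : option {fset box}) : R[i] :=
  match h with
  | Some E => if E == fset0 then 1 else so_zeta N (diag_filling a (E := E))
  | None => 0
  end.

(* Main.v *)
Require Import Defs.
From mathcomp Require Import all_boot all_order all_algebra finmap.
From mathcomp Require Import fingroup perm reals complex zify.
Import Order.TTheory GRing.Theory Num.Theory.
Local Open Scope fset_scope.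
Local Open Scope ring_scope.
Set Implicit Arguments.
Unset Strict Implicit.

(** Say that [x] may stand immediately left of [y] when [x <= y] and they are
    not both infinite. The conditions on rows and columns of an so-tableau say
    that this relation holds from each box to its right neighbour and FAILS
    from each box to the one above it: the row condition and the column
    condition are complementary ([so_tableauE]). The flag condition (SO3) only
    involves a letter and the content of its box, so it can be absorbed in the
    weight [x c m] of a letter [m] in a box of content [c]. What is to be
    proved is then an identity for arbitrary weights [x c m] in a commutative
    ring ([sum_local_tableaux]).

    A ribbon with directions [d] is a path of letters in which each step from
    content [c - 1] to content [c] uses the relation if [d c] is [FromLeft]
    and its complement if [d c] is [FromBelow]; its sum is thus a product of
    transfer matrices ([ribbon_sum], [tail]).

    The proof sweeps the diagonals of the diagram by increasing content [c].
    Suppose the boxes of content at most [c] have been filled by a tableau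
    [T]. The matrix [sweep_mx c T] has the row [i] of strip [i] counting the
    ways of ending at content [q i], and its column [k] describes how far
    strip [k] has come: not yet started ([ribbon_sum (p k) (q i)]), crossing
    the diagonal with the letter [T b] in its box [b] ([tail c (q i) (T b)]),
    or finished (unit column). For [c] below every content this is the matrix
    of ribbon sums, and for [c] above every content it is the identity. So it
    suffices that

      det (sweep_mx (c - 1) T) =
        sum over the fillings T' of diagonal c compatible with T of
          weight of diagonal c in T' * det (sweep_mx c T').

    Expanding [tail] by one step, the column of a strip through a box [b] of
    content [c] is a sum over letters [m] for [b] that are compatible with one
    neighbour of [b], the predecessor of [b] in its strip. The other neighbour
    of content [c - 1] lies on another strip [l]. Since the entries of the
    tableau increase strictly along diagonals ([entry_diag_lt]), compatibility
    of [m] with the ribbon step from the other neighbour implies compatibility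
    with the step from the predecessor; as the column condition is the
    complement of the row condition, subtracting column [l] leaves exactly the
    letters compatible with both neighbours ([column_op_meets]). These
    subtractions form a unitriangular matrix ([det_column_op]). The row of a
    strip ending at content [c - 1] has the entry 1 in the columns of all the
    strips that reach content [c - 1] or start at content [c], and 0 elsewhere;
    the subtractions turn it into a unit row, so the column of that strip may
    be replaced by a unit column ([det_spread]). Multilinearity in the columns
    then gives the identity ([det_spread_expand]).

    Finally the same identity, applied to a ribbon cut into the single strip
    formed by itself, shows that [ribbon_sum] is the so-function of that
    ribbon ([so_zeta_ribbon]), which turns the matrix of ribbon sums into the
    one of the theorem. *)

(** * Tableau conditions between neighbouring boxes *)

Definition order_convex (D : {fset box}) : Prop :=
  forall b x b' : box, b \in D -> b' \in D ->
  b.1 <= x.1 <= b'.1 -> b.2 <= x.2 <= b'.2 -> x \in D.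

Definition row_compat N (x y : letter N) : bool :=
  (x <= y)%N && ~~ (is_infty x && is_infty y).

(** Entries are addressed by boxes, so that neighbours can be named without a
    proof that they lie in [D]; outside [D] the value is a dummy. *)
Definition entry N (D : {fset box}) (M : {ffun D -> letter N}) (b : box) :
    letter N :=
  if insub b is Some y then M y else ord0.

Definition compat_at N (D : {fset box}) (M : {ffun D -> letter N}) (b : box)
    (m : letter N) : bool :=
  ((left_of b \in D) ==> row_compat (entry M (left_of b)) m)
  && ((below b \in D) ==> ~~ row_compat (entry M (below b)) m).

Lemma is_inftyE N (x : letter N) : is_infty x = (N.*2 <= x)%N.
Proof.
rewrite /is_infty -val_eqE /=; have := ltn_ord x; rewrite ltnS => xN.
by rewrite eqn_leq xN.
Qed.

Lemma row_compat_trans N (y x z : letter N) :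
  row_compat x y -> row_compat y z -> row_compat x z.
Proof. rewrite /row_compat !is_inftyE; lia. Qed.

Lemma col_compat_trans N (y x z : letter N) :
  ~~ row_compat y x -> ~~ row_compat z y -> ~~ row_compat z x.
Proof.
rewrite /row_compat !is_inftyE.
have := ltn_ord x; have := ltn_ord y; have := ltn_ord z; lia.
Qed.

Lemma col_compatE N (x y : letter N) :
  ~~ row_compat y x = (x < y)%N || is_infty x && is_infty y.
Proof. rewrite /row_compat !is_inftyE; lia. Qed.

Lemma entry_val N (D : {fset box}) (M : {ffun D -> letter N}) (y : D) :
  entry M (val y) = M y.
Proof. by rewrite /entry valK. Qed.

(** Convexity of the diagram makes the boxes between two boxes of a row or
    column available, so that the conditions on neighbours propagate by
    transitivity. *)
Section LocalTableau.
Variables (N : nat) (D : {fset box}) (M : {ffun D -> letter N}).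
Hypothesis convD : order_convex D.
Hypothesis okM : forall y : D, compat_at M (val y) (M y).

Lemma row_compat_entry i j k : (i, j) \in D -> (i, j + k.+1%:Z) \in D ->
  row_compat (entry M (i, j)) (entry M (i, j + k.+1%:Z)).
Proof.
elim: k => [|k IHk] ijD ijkD.
  have /andP[/implyP + _] := okM [` ijkD]; rewrite -entry_val /=.
  by rewrite /left_of /= (_ : j + 1 - 1 = j); [exact | lia].
have ijkD' : (i, j + k.+1%:Z) \in D by apply: (convD ijD ijkD) => /=; lia.
apply: row_compat_trans (IHk ijD ijkD') _.
have /andP[/implyP + _] := okM [` ijkD]; rewrite -entry_val /=.
by rewrite /left_of /= (_ : j + k.+2%:Z - 1 = j + k.+1%:Z); [exact | lia].
Qed.

Lemma col_compat_entry i j k : (i, j) \in D -> (i + k.+1%:Z, j) \in D ->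
  ~~ row_compat (entry M (i + k.+1%:Z, j)) (entry M (i, j)).
Proof.
elim: k => [|k IHk] ijD ijkD.
  have /andP[_ /implyP] := okM [` ijD]; rewrite -entry_val /=; exact.
have ijkD' : (i + k.+1%:Z, j) \in D by apply: (convD ijD ijkD) => /=; lia.
apply: col_compat_trans (IHk ijD ijkD') _.
have /andP[_ /implyP] := okM [` ijkD']; rewrite -entry_val /=.
by rewrite /below /= (_ : i + k.+1%:Z + 1 = i + k.+2%:Z); [exact | lia].
Qed.

End LocalTableau.

(** Condition (SO3) for a letter in a box of content [c]. *)
Definition flag_ok N (c : int) (m : letter N) : bool :=
  (c <= 0) ==> letter_ge m (`|c|%N).+1.

(** The rule that infinity does not repeat in a row and the exemption that
    lets it repeat in a column merge into [row_compat] and its negation. *)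
Lemma so_tableauE N (D : {fset box}) (M : {ffun D -> letter N}) :
  order_convex D ->
  so_tableau M = [forall y : D, compat_at M (val y) (M y)]
                 && [forall y : D, flag_ok (content (val y)) (M y)].
Proof.
move=> convD; apply/and4P/andP.
  case=> rowM colM flagM inftyM; split=> //.
  apply/forallP=> y; apply/andP; split; apply/implyP=> zD.
    have := forallP (forallP rowM [` zD]) y; rewrite /= eqxx /=.
    have := forallP (forallP inftyM [` zD]) y; rewrite /= eqxx /=.
    rewrite -(entry_val M [`zD]) /row_compat /= => /implyP inf le.
    have -> /= : (entry M (left_of (val y)) <= M y)%N.
      by apply: (implyP le); rewrite gtrBl.
    apply/negP=> /inf /eqP/(congr1 val) /= /(congr1 snd) /= /eqP.
    by rewrite subr_eq addrC -subr_eq subrr.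
  have := forallP (forallP colM y) [` zD]; rewrite /= eqxx /=.
  rewrite -(entry_val M [`zD]) col_compatE /= => /implyP; apply.
  by rewrite ltrDl.
case=> /forallP okM flagM; split=> //.
- apply/forallP=> -[[i j] xD]; apply/forallP=> -[[i' j'] yD] /=.
  apply/implyP=> /andP[/eqP eqi ltj]; rewrite -!entry_val /=.
  move: yD; rewrite -eqi (_ : j' = j + (`|j' - j|%N.-1).+1%:Z); last by lia.
  by move=> yD; case/andP: (row_compat_entry convD okM xD yD).
- apply/forallP=> -[[i j] xD]; apply/forallP=> -[[i' j'] yD] /=.
  apply/implyP=> /andP[/eqP eqj lti]; rewrite -!entry_val /=.
  move: yD; rewrite -eqj (_ : i' = i + (`|i' - i|%N.-1).+1%:Z); last by lia.
  move=> yD; by have := col_compat_entry convD okM xD yD; rewrite col_compatE.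
apply/forallP=> x; apply/forallP=> y; apply/implyP=> /and3P[/eqP eqi inx iny].
apply/eqP/val_inj; case: x y eqi inx iny => [[i j] xD] [[i' j'] yD] /= eqi.
rewrite -!entry_val /=; subst i'.
case: (ltrgtP j j') => [lt|lt|->//].
  move: yD; rewrite (_ : j' = j + (`|j' - j|%N.-1).+1%:Z); last by lia.
  move=> yD; have := row_compat_entry convD okM xD yD.
  by rewrite /row_compat => /andP[_ /negP h] h1 h2; case: h; rewrite h1.
move: xD; rewrite (_ : j = j' + (`|j' - j|%N.-1).+1%:Z); last by lia.
move=> xD; have := row_compat_entry convD okM yD xD.
by rewrite /row_compat => /andP[_ /negP h] h1 h2; case: h; rewrite h1 h2.
Qed.

(** * Two evaluations of determinants *)

(** A permutation contributing to the Leibniz formula never decreases [rk]; as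
    it preserves the sum of the ranks it fixes every index. This spares
    reordering the indices to make the matrix triangular. *)
Lemma det_unitriangular_rank (F : comPzRingType) n (A : 'M[F]_n)
    (rk : 'I_n -> int) :
  (forall i, A i i = 1) ->
  (forall i j, A i j != 0 -> i != j -> rk i < rk j) -> \det A = 1.
Proof.
move=> A1 Ark; rewrite /determinant (bigD1 (1%g : {perm 'I_n})) //=.
rewrite odd_perm1 expr0 mul1r.
rewrite [X in X + _]big1 => [|i _]; last by rewrite perm1.
rewrite big1 ?addr0 // => s /eqP s1.
have [/existsP[i /eqP Ai0]|/existsPn As] := boolP [exists i, A i (s i) == 0].
  by rewrite (bigD1 i) //= Ai0 mul0r mulr0.
have le_rk i : rk i <= rk (s i).
  by have [/eqP <-|ne] := boolP (i == s i); [|exact/ltW/Ark].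
have sum_rk : \sum_i (rk (s i) - rk i) = 0.
  by rewrite sumrB [X in _ - X](reindex_inj (@perm_inj _ s)) subrr.
case: s1; apply/permP=> i; rewrite perm1; apply/eqP/negPn/negP => ne.
have /eqP := sum_rk; rewrite psumr_eq0 => [|j _]; last by rewrite subr_ge0.
move=> /allP/(_ i (mem_index_enum _))/=; rewrite subr_eq0 => /eqP eq_rk.
by have := Ark _ _ (As i); rewrite eq_sym eq_rk ltxx => /(_ ne).
Qed.

(** Only the minor obtained by deleting row and column [i0] survives the
    expansion along row [i0]. *)
Lemma det_unit_row (F : comPzRingType) n (A B : 'M[F]_n) (i0 : 'I_n) :
  (forall j, A i0 j = (i0 == j)%:R) -> (forall j, B i0 j = (i0 == j)%:R) ->
  (forall i j, j != i0 -> A i j = B i j) -> \det A = \det B.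
Proof.
move=> Ai0 Bi0 AB; rewrite !(expand_det_row _ i0); apply: eq_bigr => j _.
rewrite Ai0 Bi0; have [<-|_] := eqVneq; last by rewrite !mul0r.
congr (_ * (_ * \det _)); apply/matrixP => k l; rewrite !mxE AB //.
by rewrite eq_sym neq_lift.
Qed.

Lemma det_columns (F : comPzRingType) n (A : 'M[F]_n) :
  \det A = \sum_(s : 'S_n) (-1) ^+ s * \prod_k A (s k) k.
Proof.
rewrite -det_tr; apply: eq_bigr => s _; congr (_ * _).
by apply: eq_bigr => k _; rewrite mxE.
Qed.

(** * Steps between consecutive diagonals *)

(** The neighbour of content one less that a strip approaching [b] from
    direction [dir] does not come from. *)
Definition co_predecessor (dir : direction) (b : box) : box :=
  match dir with FromLeft => below b | FromBelow => left_of b end.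

Definition step_compat N (dir : direction) (x y : letter N) : bool :=
  match dir with
  | FromLeft => row_compat x y
  | FromBelow => ~~ row_compat x y
  end.

Lemma content_predecessor dir b : content (predecessor dir b) = content b - 1.
Proof. by case: dir b => [] [i j]; rewrite /content /=; lia. Qed.

Lemma content_co_predecessor dir b :
  content (co_predecessor dir b) = content b - 1.
Proof. by case: dir b => [] [i j]; rewrite /content /=; lia. Qed.

Lemma content_successor dir b : content (successor dir b) = content b + 1.
Proof. by case: dir b => [] [i j]; rewrite /content /=; lia. Qed.

Lemma successorK dir : cancel (successor dir) (predecessor dir).
Proof. by case: dir => -[i j]; congr pair => /=; lia. Qed.

Lemma box_eq (b b' : box) : b.1 = b'.1 -> b.2 = b'.2 -> b = b'.
Proof. by case: b b' => i j [i' j'] /= -> ->. Qed.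

Lemma predecessor_inj dir : injective (predecessor dir).
Proof. by case: dir => -[i j] [i' j'] [] => eq1 eq2; congr pair => /=; lia. Qed.

Lemma co_predecessor_neq dir b : co_predecessor dir b != predecessor dir b.
Proof.
by case: dir b => [] [i j]; apply/eqP; rewrite /below /left_of /= => -[]; lia.
Qed.

(** Because the two conditions are complementary, the condition from the other
    neighbour is always the negation of a ribbon step, for both directions. *)
Lemma compat_at_split N (D : {fset box}) (M : {ffun D -> letter N}) dir b m :
  compat_at M b m =
  ((predecessor dir b \in D) ==>
     step_compat dir (entry M (predecessor dir b)) m)
  && ((co_predecessor dir b \in D) ==>
     ~~ step_compat dir (entry M (co_predecessor dir b)) m).
Proof. by case: dir; rewrite /compat_at //= negbK andbC. Qed.

Lemma compat_at_eq N (D : {fset box}) (M M' : {ffun D -> letter N}) b m :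
  (forall y : D, content (val y) = content b - 1 -> M y = M' y) ->
  compat_at M b m = compat_at M' b m.
Proof.
move=> MM'; have E dir : predecessor dir b \in D ->
    entry M (predecessor dir b) = entry M' (predecessor dir b).
  move=> bD; have := MM' [` bD]; rewrite -!entry_val /= content_predecessor.
  exact.
by congr (_ && _); apply/implyP/implyP=> + bD => /(_ bD);
  rewrite (E FromLeft, E FromBelow).
Qed.

Lemma compat_diag_lt N (z x y : letter N) :
  ~~ row_compat z x -> row_compat z y -> (x < y)%N.
Proof. rewrite /row_compat !is_inftyE; have := ltn_ord y; lia. Qed.

(** The box diagonally between the two neighbours, below the left one and left
    of the lower one, has content [content b - 2] and lies in [D] by
    convexity; comparing both entries with its entry gives strictness. *)
Lemma entry_diag_lt N (D : {fset box}) (M : {ffun D -> letter N}) b :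
  order_convex D ->
  (forall y : D, content (val y) < content b -> compat_at M (val y) (M y)) ->
  left_of b \in D -> below b \in D ->
  (entry M (left_of b) < entry M (below b))%N.
Proof.
case: b => i j convD okM lD bD; set z : box := (i + 1, j - 1).
have zD : z \in D.
  by apply: (convD _ _ _ lD bD); rewrite /z /left_of /below /=; lia.
have /andP[_ /implyP/(_ zD)] : compat_at M (left_of (i, j)) (M [` lD]).
  by apply: (okM [` lD]); rewrite /content /=; lia.
have /andP[/implyP/(_ zD) + _] : compat_at M (below (i, j)) (M [` bD]).
  by apply: (okM [` bD]); rewrite /content /=; lia.
by rewrite -!entry_val => zb zl; apply: compat_diag_lt zl zb.
Qed.

(** The conditions on the two neighbours are nested, so their indicator
    functions subtract to the indicator function of a set of letters. *)
Lemma step_compat_mono N (D : {fset box}) (M : {ffun D -> letter N}) dir b m :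
  (entry M (left_of b) < entry M (below b))%N ->
  step_compat dir (entry M (co_predecessor dir b)) m ->
  step_compat dir (entry M (predecessor dir b)) m.
Proof. case: dir; rewrite /= /row_compat !is_inftyE; lia. Qed.

(** * Sums over ribbons *)
Section RibbonSum.
Variables (F : comPzRingType) (N : nat) (x : int -> letter N -> F).
Variable d : int -> direction.

Fixpoint tail_sum (r : nat) (c : int) (m : letter N) : F :=
  if r is r'.+1 then
    \sum_m' (step_compat (d (c + 1)) m m')%:R
            * (x (c + 1) m' * tail_sum r' (c + 1) m')
  else 1.

(** Zero if the content [q] has been passed. The weight of the letter [m]
    itself is left out: it is accounted for when the diagonal of content [c]
    is filled. *)
Definition tail (c q : int) (m : letter N) : F :=
  if c <= q then tail_sum `|q - c|%N c m else 0.

(** The second term is the value [1] of the empty ribbon, for which [p = q +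
    1]. *)
Definition ribbon_sum (p q : int) : F :=
  \sum_m x p m * tail p q m + (q == p - 1)%:R.

(** The Kronecker term is the only contribution of a strip ending at [c - 1];
    as it does not depend on [m], it cancels in differences. *)
Lemma tail_step c q m :
  tail (c - 1) q m =
  \sum_m' (step_compat (d c) m m')%:R * (x c m' * tail c q m')
  + (q == c - 1)%:R.
Proof.
rewrite /tail; case: (ltrgtP q (c - 1)) => [lt|gt|->] /=.
- rewrite addr0 big1 // => m' _; rewrite (_ : c <= q = false) ?mulr0 //; lia.
- rewrite addr0 (_ : c <= q = true); last by lia.
  rewrite (_ : `|q - (c - 1)%R|%N = `|q - c|%N.+1); last by lia.
  by rewrite /= subrK.
rewrite big1 ?add0r => [|m' _]; first by rewrite subrr.
rewrite (_ : c <= _ = false) ?mulr0 //; lia.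
Qed.

End RibbonSum.

(** * Diagrams cut into strips *)

(** What the sweep needs to know about an outside decomposition, where
    [p k] and [q k] are the contents of the ends of strip [k]. The symmetric
    property of the last boxes of strips is a consequence ([successor_notin]). *)
Record strip_cover (D : {fset box}) n (theta : 'I_n -> {fset box})
    (d : int -> direction) (p q : 'I_n -> int) : Prop := StripCover {
  sc_cover : forall b, b \in D <-> exists k, b \in theta k;
  sc_disjoint : forall k l b, b \in theta k -> b \in theta l -> k = l;
  sc_content : forall k b, b \in theta k -> p k <= content b <= q k;
  sc_uniq : forall k b b', b \in theta k -> b' \in theta k ->
    content b = content b' -> b = b';
  sc_last : forall k, exists2 b, b \in theta k & content b = q k;
  sc_pred : forall k b, b \in theta k -> content b != p k ->
    predecessor (d (content b)) b \in theta k;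
  sc_first : forall k b, b \in theta k -> content b = p k ->
    predecessor (d (content b)) b \notin D
}.

Section Strips.
Variables (D : {fset box}) (n : nat) (theta : 'I_n -> {fset box}).
Variables (d : int -> direction) (p q : 'I_n -> int).
Hypothesis cov : strip_cover D theta d p q.

(** The default value is reached only if strip [k] has no box of content
    [c]. *)
Definition strip_box (k : 'I_n) (c : int) : box :=
  head (0, 0) [seq b <- theta k | content b == c].

Lemma strip_sub k b : b \in theta k -> b \in D.
Proof. by move=> bk; apply/(sc_cover cov); exists k. Qed.

Lemma strip_box_content k b : b \in theta k -> strip_box k (content b) = b.
Proof.
move=> bk; rewrite /strip_box; set s := [seq _ <- _ | _].
have : b \in s by rewrite mem_filter eqxx.
have sP b' : b' \in s -> b' \in theta k /\ content b' = content b.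
  by rewrite mem_filter => /andP[/eqP -> ->].
case: s sP => //= b' s /(_ b' (mem_head _ _))[b'k eqc] _.
exact: (sc_uniq cov b'k bk eqc).
Qed.

(** Walk back along the predecessors from the last box of the strip. *)
Lemma strip_boxP k c : p k <= c <= q k ->
  strip_box k c \in theta k /\ content (strip_box k c) = c.
Proof.
move=> /andP[pc cq].
suff [b bk <-] : exists2 b, b \in theta k & content b = c.
  by rewrite (strip_box_content bk).
rewrite (_ : c = q k - `|q k - c|%N%:Z); last by lia.
have : `|q k - c|%N%:Z <= q k - p k by lia.
elim: `|_|%N => [|r IHr] ler; first by rewrite subr0; exact: (sc_last cov k).
have [|b bk bc] := IHr; first by lia.
exists (predecessor (d (content b)) b).
  by apply: (sc_pred cov bk); apply/eqP; lia.
by rewrite content_predecessor bc; lia.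
Qed.

Lemma strip_le k : p k <= q k.
Proof. by have [b /(sc_content cov)] := sc_last cov k; lia. Qed.

Fact strip_index_ex (y : D) : exists k, val y \in theta k.
Proof. by apply/(sc_cover cov); exact: valP. Qed.

Definition strip_index (y : D) : 'I_n := xchoose (strip_index_ex y).

Lemma strip_indexP (y : D) : val y \in theta (strip_index y).
Proof. exact: (xchooseP (strip_index_ex y)). Qed.

Lemma strip_index_eq (y : D) k : val y \in theta k -> strip_index y = k.
Proof. by move=> yk; exact: (sc_disjoint cov (strip_indexP y) yk). Qed.

Lemma prod_strip_diagonal (F : comPzRingType) (c : int) (f : 'I_n -> F) :
  \prod_(k | p k <= c <= q k) f k
  = \prod_(y : D | content (val y) == c) f (strip_index y).
Proof.
rewrite [RHS](partition_big strip_index (fun k => p k <= c <= q k)) /=; last first.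
  by move=> y /eqP <-; exact: (sc_content cov (strip_indexP y)).
apply: eq_bigr => k /strip_boxP[bk bc].
rewrite (big_pred1 [` strip_sub bk]) => [|y] /=.
  by rewrite (strip_index_eq (k := k)).
apply/andP/eqP => [[/eqP yc /eqP yk]|->] /=; last first.
  by rewrite bc eqxx (strip_index_eq (k := k)).
apply/val_inj => /=; apply: (sc_uniq cov _ bk); last by rewrite bc.
by rewrite -yk strip_indexP.
Qed.

End Strips.

(** * Sweeping one diagonal *)
Section Sweep.
Variables (F : comPzRingType) (N : nat) (x : int -> letter N -> F).
Variables (D : {fset box}) (n : nat) (theta : 'I_n -> {fset box}).
Variables (d : int -> direction) (p q : 'I_n -> int).
Hypothesis convD : order_convex D.
Hypothesis cov : strip_cover D theta d p q.

Local Notation tail := (tail x d).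
Local Notation ribbon_sum := (ribbon_sum x d).
Local Notation strip_box := (strip_box theta).
Local Notation strip_index := (strip_index cov).

Definition sweep_mx (c : int) (T : {ffun D -> letter N}) : 'M[F]_n :=
  \matrix_(i, j)
    if c < p j then ribbon_sum (p j) (q i)
    else if c <= q j then tail c (q i) (entry T (strip_box j c))
    else (i == j)%:R.

Section Step.
Variables (c : int) (T : {ffun D -> letter N}).
Hypothesis okT :
  forall y : D, content (val y) < c -> compat_at T (val y) (T y).

Local Notation pred_c := (predecessor (d c)).
Local Notation other_c := (co_predecessor (d c)).
Local Notation meets k := (p k <= c <= q k).

Lemma strip_box_pred k : meets k -> p k < c ->
  pred_c (strip_box k c) = strip_box k (c - 1).
Proof.
move=> kc pc; have [bk bc] := strip_boxP cov kc.
have pk : predecessor (d c) (strip_box k c) \in theta k.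
  by rewrite -{1}bc; apply: (sc_pred cov bk); rewrite bc; apply/eqP; lia.
by rewrite -(strip_box_content cov pk) content_predecessor bc.
Qed.

Lemma pred_in k : meets k -> (pred_c (strip_box k c) \in D) = (p k < c).
Proof.
move=> kc; have [bk bc] := strip_boxP cov kc.
case: (ltP (p k) c) => pc; last first.
  by apply/negbTE; rewrite -{1}bc; apply: (sc_first cov bk); rewrite bc; lia.
rewrite strip_box_pred //; apply: (strip_sub cov (k := k)).
by have [] : _ /\ _ := strip_boxP cov (k := k) (c := c - 1) _; first by lia.
Qed.

Lemma other_strip k l : meets k -> other_c (strip_box k c) \in theta l ->
  p l <= c - 1 <= q l /\ other_c (strip_box k c) = strip_box l (c - 1).
Proof.
move=> /(strip_boxP cov)[_ bc] ol; split.
  by have := sc_content cov ol; rewrite content_co_predecessor bc.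
by rewrite -[LHS](strip_box_content cov ol) content_co_predecessor bc.
Qed.

(** Otherwise the box following [b] would belong to a strip that either starts
    there, although its predecessor [b] is in [D], or passes through [b]. *)
Lemma successor_notin i b : b \in theta i -> content b = q i -> q i = c - 1 ->
  successor (d c) b \notin D.
Proof.
move=> bi bq qc; apply/negP => sD.
have sc : content (successor (d c) b) = c.
  by rewrite content_successor; lia.
have [j sj] := (sc_cover cov _).1 sD.
have [eqp|ne] := eqVneq (content (successor (d c) b)) (p j).
  have := sc_first cov sj eqp; rewrite sc successorK.
  by rewrite (strip_sub cov bi).
have := sc_pred cov sj ne; rewrite sc successorK => bj.
have := sc_content cov sj; rewrite -(sc_disjoint cov bi bj) sc; lia.
Qed.

(** Of two boxes of content [c - 1], the successor of one of them lies between
    them, hence in [D] by convexity. *)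
Lemma end_uniq i j : q i = c - 1 -> q j = c - 1 -> i = j.
Proof.
move=> qi qj; have [b bi bq] := sc_last cov i; have [b' bj bq'] := sc_last cov j.
have := successor_notin bi bq qi; have := successor_notin bj bq' qj.
have bD := strip_sub cov bi; have b'D := strip_sub cov bj.
have bc : content b = c - 1 by lia.
have b'c : content b' = c - 1 by lia.
have [bb' _ _|] := eqVneq b b'.
  by apply: (sc_disjoint cov bi); rewrite bb'.
move: b b' bc b'c bD b'D {bi bj bq bq'} => [i1 j1] [i2 j2].
rewrite /content /= => bc b'c bD b'D /eqP ne sb' sb.
have ltD i3 j3 i4 j4 : (i3, j3) \in D -> (i4, j4) \in D -> j3 - i3 = c - 1 ->
    j4 - i4 = c - 1 -> i3 < i4 ->
    successor (d c) (i3, j3) \in D \/ successor (d c) (i4, j4) \in D.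
  move=> bD3 bD4 eq3 eq4 lt34; case: (d c); [left | right];
    apply: (convD bD3 bD4) => /=; lia.
case: (ltrgtP i1 i2) => [lt|lt|eqi].
- by case: (ltD _ _ _ _ bD b'D bc b'c lt) => sD; move: sb sb'; rewrite sD.
- by case: (ltD _ _ _ _ b'D bD b'c bc lt) => sD; move: sb sb'; rewrite sD.
by case: ne; congr pair; lia.
Qed.

(** Here convexity is applied between the last box of strip [i] and the box of
    strip [k], in the order in which they occur. *)
Lemma end_other i k : q i = c - 1 -> meets k -> other_c (strip_box k c) \in D.
Proof.
move=> qi kc; have [bk bc] := strip_boxP cov kc.
have [e ei eq] := sc_last cov i; have := successor_notin ei eq qi.
have eD := strip_sub cov ei; have bD := strip_sub cov bk.
have ec : content e = c - 1 by lia.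
move: (strip_box k c) bc bD e ec eD {ei eq bk} => [i1 j1] bc bD [i2 j2] ec eD.
rewrite /content /= in bc ec.
have [le|lt] := lerP i2 i1; case: (d c) => /= sD.
- by case/negP: sD; apply: (convD eD bD) => /=; lia.
- by apply: (convD eD bD) => /=; lia.
- by apply: (convD bD eD) => /=; lia.
by case/negP: sD; apply: (convD bD eD) => /=; lia.
Qed.

(** Strips starting at content [c] and strips arriving from content [c - 1]
    follow one formula: a missing predecessor imposes no condition. *)
Lemma sweep_pred_col i k : meets k ->
  sweep_mx (c - 1) T i k =
  \sum_m ((pred_c (strip_box k c) \in D) ==>
           step_compat (d c) (entry T (pred_c (strip_box k c))) m)%:R
         * (x c m * tail c (q i) m)
  + (q i == c - 1)%:R.
Proof.
move=> kc; have /andP[pc cq] := kc; rewrite mxE pred_in //.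
case: (ltrgtP (p k) c) pc => // [lt|eqc] _ /=.
  rewrite strip_box_pred // -tail_step.
  have -> : (c - 1 < p k) = false by lia.
  by have -> : (c - 1 <= q k) = true by lia.
rewrite eqc (_ : c - 1 < c = true); last by lia.
by rewrite /ribbon_sum; congr (_ + _); apply: eq_bigr => m _; rewrite mul1r.
Qed.

Definition contains_other (l k : 'I_n) : bool :=
  meets k && (other_c (strip_box k c) \in theta l).

Definition column_op : 'M[F]_n :=
  \matrix_(l, k) ((l == k)%:R - (contains_other l k)%:R).

(** From a strip to the strip of its other neighbour the diagonal [c - 1] is
    traversed monotonically, downwards or upwards according to [d c], so the
    row number, up to sign, is a rank that makes the matrix unitriangular. *)
Lemma det_column_op : \det column_op = 1.
Proof.
(* The box of strip k on diagonal c - 1, or the box outside D just before its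
   first box if the strip starts on diagonal c. *)
pose side k := if meets k then pred_c (strip_box k c) else strip_box k (c - 1).
pose sgn : int := if d c is FromLeft then -1 else 1.
apply: (@det_unitriangular_rank _ _ _ (fun k => sgn * (side k).1)).
  move=> k; rewrite mxE eqxx [contains_other k k](_ : _ = false) ?subr0 //.
  apply/negP => /andP[kc ok]; have [/andP[pc1 _] oE] := other_strip kc ok.
  have := co_predecessor_neq (d c) (strip_box k c).
  by rewrite oE strip_box_pred ?eqxx //; lia.
move=> l k + lk; rewrite mxE (negbTE lk) sub0r oppr_eq0.
case: (boolP (contains_other l k)) => [/andP[kc ol] _|]; last by rewrite eqxx.
have [l1 oE] := other_strip kc ol.
have -> : side l = other_c (strip_box k c).
  rewrite oE /side; case: ifP => // lc; rewrite strip_box_pred //; lia.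
rewrite /side kc /sgn; case: (strip_box k c) => i j.
by case: (d c) => /=; lia.
Qed.

Lemma mul_column_opE (A : 'M[F]_n) i k :
  (A *m column_op) i k = A i k - \sum_(l | contains_other l k) A i l.
Proof.
rewrite !mxE; under eq_bigr do rewrite mxE mulrBr.
rewrite sumrB; congr (_ - _).
  rewrite (bigD1 k) //= eqxx mulr1 big1 ?addr0 // => l /negbTE ->.
  by rewrite mulr0.
rewrite [RHS]big_mkcond; apply: eq_bigr => l _.
by case: ifP; rewrite ?mulr1 ?mulr0.
Qed.

(** The matrix obtained when each column of a strip meeting diagonal [c] has
    become a sum over the letters allowed by both neighbours, ready for
    expansion. *)
Definition spread_mx : 'M[F]_n :=
  \matrix_(i, k)
    if meets k then
      \sum_m (compat_at T (strip_box k c) m)%:R * (x c m * tail c (q i) m)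
    else sweep_mx c T i k.

(** If the box has no other neighbour in [D] there is nothing to subtract;
    then no strip ends at [c - 1] ([end_other]), so the Kronecker term of
    [sweep_pred_col] vanishes by itself. *)
Lemma column_op_meets i k : meets k ->
  (sweep_mx (c - 1) T *m column_op) i k = spread_mx i k.
Proof.
move=> kc; rewrite mul_column_opE [RHS]mxE kc sweep_pred_col //.
have [bk bc] := strip_boxP cov kc.
have [oD|oD] := boolP (other_c (strip_box k c) \in D); last first.
  rewrite [X in _ - X]big_pred0 ?subr0 => [|l]; last first.
    by rewrite /contains_other kc /=; apply: contraNF oD => /(strip_sub cov).
  rewrite (_ : _ == _ = false) ?addr0; last first.
    by apply/negP => /eqP qi; move: oD; rewrite (end_other qi kc).
  by apply: eq_bigr => m _; rewrite (compat_at_split _ (d c)) (negbTE oD) andbT.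
have [l ol] := (sc_cover cov _).1 oD; have [l1 oE] := other_strip kc ol.
rewrite [X in _ - X](big_pred1 l) => [|l']; last first.
  rewrite /contains_other kc /=; apply/idP/eqP => [ol'|->//].
  exact: (sc_disjoint cov ol' ol).
rewrite [sweep_mx _ _ i l]mxE -oE (_ : c - 1 < p l = false); last by lia.
rewrite (_ : c - 1 <= q l = true) ?tail_step; last by lia.
rewrite opprD addrACA subrr addr0 -sumrB; apply: eq_bigr => m _.
rewrite -mulrBl (compat_at_split _ (d c)) oD /=; congr (_ * _).
have mono : (pred_c (strip_box k c) \in D) ->
    step_compat (d c) (entry T (other_c (strip_box k c))) m ->
    step_compat (d c) (entry T (pred_c (strip_box k c))) m.
  move=> pD; apply: step_compat_mono; apply: entry_diag_lt => //.
  - by move=> y; rewrite bc => /okT.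
  - by case: (d c) pD oD.
  - by case: (d c) pD oD.
case: (_ \in D) mono => /= [/(_ isT)|_].
  case: (step_compat _ (entry T (other_c _)) m) => [-> //|_] /=.
    by rewrite subrr.
  by rewrite subr0 andbT.
by case: (step_compat _ (entry T (other_c _)) m); rewrite ?subrr ?subr0.
Qed.

Lemma column_op_other i k : ~~ meets k ->
  (sweep_mx (c - 1) T *m column_op) i k = sweep_mx (c - 1) T i k.
Proof.
move=> /negbTE kc; rewrite mul_column_opE big_pred0 ?subr0 // => l.
by rewrite /contains_other kc.
Qed.

Lemma sweep_mx_ended i k : ~~ meets k -> q k != c - 1 ->
  sweep_mx (c - 1) T i k = sweep_mx c T i k.
Proof.
move=> kc /eqP qk; have pq := strip_le cov k; rewrite !mxE.
have [cp|pc] := ltrP c (p k); first by have -> : (c - 1 < p k) = true by lia.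
have -> : (c - 1 < p k) = false by lia.
have -> : (c - 1 <= q k) = false by lia.
by have -> : (c <= q k) = false by lia.
Qed.

(** A strip [i0] ending at [c - 1] is unique ([end_uniq]). Its row meets only
    its own column once the subtractions are done, so that column can be made
    a unit column without changing the determinant. *)
Lemma det_spread : \det (sweep_mx (c - 1) T) = \det spread_mx.
Proof.
rewrite -[LHS]mulr1 -det_column_op -det_mulmx.
case: (pickP (fun i => q i == c - 1)) => [i0 /eqP qi0|qn]; last first.
  congr (\det _); apply/matrixP => i k.
  have [kc|kc] := boolP (meets k); first exact: column_op_meets.
  by rewrite column_op_other // [RHS]mxE (negbTE kc) sweep_mx_ended ?qn.
have nc k : q k = c - 1 -> ~~ meets k by move=> ->; lia.
have spread0 k : spread_mx i0 k = (i0 == k)%:R.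
  rewrite mxE; case: ifP => kc.
    rewrite big1 => [|m _]; last first.
      by rewrite /tail qi0 (_ : c <= c - 1 = false) ?mulr0 //; lia.
    by case: eqP kc => // <-; rewrite qi0; lia.
  rewrite mxE; case: (ltrP c (p k)) => cp.
    rewrite /ribbon_sum big1 => [|m _]; last first.
      by rewrite /tail qi0 (_ : p k <= c - 1 = false) ?mulr0 //; lia.
    have -> : (q i0 == p k - 1) = false by rewrite qi0; lia.
    rewrite add0r; case: eqVneq => // ik; have := strip_le cov k.
    by rewrite -ik qi0 ik; lia.
  by case: (lerP c (q k)) => // cq; move: kc; rewrite cp cq.
apply: (det_unit_row (i0 := i0)) => //.
  move=> k; have [kc|kc] := boolP (meets k); first by rewrite column_op_meets.
  rewrite column_op_other //; have [qk|qk] := eqVneq (q k) (c - 1).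
    rewrite (end_uniq qi0 qk) eqxx mxE qk lexx.
    rewrite (_ : c - 1 < p k = false); last by have := strip_le cov k; lia.
    by rewrite /tail lexx subrr.
  by rewrite sweep_mx_ended // -spread0 [RHS]mxE (negbTE kc).
move=> i k ki0; have [kc|kc] := boolP (meets k); first exact: column_op_meets.
rewrite column_op_other // sweep_mx_ended //; last first.
  by apply: contra_neq ki0 => qk; apply: end_uniq.
by rewrite [RHS]mxE (negbTE kc).
Qed.

(** The letters allowed at [y] when diagonal [c] of [T] is filled again and
    the rest is kept; sums over fillings of one diagonal are sums over [family
    refill]. *)
Definition refill (y : D) : {pred letter N} :=
  if content (val y) == c then predT else pred1 (T y).

Lemma refill_off T' (y : D) : T' \in family refill -> content (val y) != c ->
  T' y = T y.
Proof.
by move=> /familyP/(_ y) + /negbTE yc; rewrite /refill yc inE => /eqP.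
Qed.

Lemma entry_strip_box (T' : {ffun D -> letter N}) (y : D) :
  content (val y) = c -> entry T' (strip_box (strip_index y) c) = T' y.
Proof. by move=> <-; rewrite (strip_box_content cov) ?entry_val ?strip_indexP. Qed.

Lemma det_spread_expand :
  \det spread_mx =
  \sum_(T' in family refill)
    (\prod_(y : D | content (val y) == c)
        ((compat_at T (val y) (T' y))%:R * x c (T' y)))
    * \det (sweep_mx c T').
Proof.
rewrite det_columns; under [RHS]eq_bigr do rewrite det_columns mulr_sumr.
rewrite exchange_big /=; apply: eq_bigr => s _.
under [RHS]eq_bigr do rewrite mulrCA.
rewrite -mulr_sumr; congr (_ * _).
(* Away from diagonal c the factor is 1 and a single letter is allowed, so a
   product over the diagonal is a product over D, and distributing it gives a
   sum over fillings of D. *)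
pose term (y : D) m := if content (val y) == c then
  (compat_at T (val y) m)%:R * x c m * tail c (q (s (strip_index y))) m else 1.
rewrite (bigID (fun k => meets k)) /=.
transitivity ((\sum_(T' in family refill) \prod_y term y (T' y))
   * \prod_(k | ~~ meets k) sweep_mx c T (s k) k).
  congr (_ * _); last first.
    by apply: eq_bigr => k /negbTE kc; rewrite !mxE kc.
  rewrite -bigA_distr_big_dep.
  under eq_bigr => k kc do rewrite !mxE kc.
  rewrite (prod_strip_diagonal cov) big_mkcond /=; apply: eq_bigr => y _.
  rewrite /refill /term; case: eqP => yc; last by rewrite big_pred1_eq.
  apply: eq_bigr => m _; rewrite mulrA -yc (strip_box_content cov) //.
  exact: strip_indexP.
rewrite mulr_suml; apply: eq_bigr => T' T'fam.
rewrite [X in _ = _ * X](bigID (fun k => meets k)) /= mulrA; congr (_ * _).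
  rewrite -big_mkcond /= -[LHS]/(\prod_(y | _) (_ * _)) big_split /=.
  congr (_ * _); under [RHS]eq_bigr => k kc.
    rewrite !mxE; have /andP[pc cq] := kc.
    rewrite ltNge pc cq /=; over.
  rewrite (prod_strip_diagonal cov); apply: eq_bigr => y /eqP yc.
  by rewrite entry_strip_box.
apply: eq_bigr => k kc; rewrite !mxE.
case: ltrP kc => //= pc; case: lerP => //=.
Qed.

End Step.

(** * Sweeping the whole diagram *)
Definition agree (c : int) (T M : {ffun D -> letter N}) : bool :=
  [forall y : D, (content (val y) <= c) ==> (M y == T y)].

Definition local_tableau (M : {ffun D -> letter N}) : bool :=
  [forall y : D, compat_at M (val y) (M y)].

(** The value that the sweep will give to the determinant at [T]. *)
Definition completions (c : int) (T : {ffun D -> letter N}) : F :=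
  \sum_(M | agree c T M && local_tableau M)
    \prod_(y : D | c < content (val y)) x (content (val y)) (M y).

Lemma compat_at_agree c (T M : {ffun D -> letter N}) (y : D) :
  agree c T M -> content (val y) <= c ->
  compat_at M (val y) (M y) = compat_at T (val y) (T y).
Proof.
move=> /forallP TM yc; have /eqP -> := implyP (TM y) yc.
by apply: compat_at_eq => z zc; apply/eqP/(implyP (TM z)); lia.
Qed.

Definition merge_at c (T M : {ffun D -> letter N}) : {ffun D -> letter N} :=
  [ffun y : D => if content (val y) == c then M y else T y].

Lemma agree_merge c (T T' M : {ffun D -> letter N}) :
  T' \in family (refill c T) ->
  agree (c - 1) T M && (merge_at c T M == T') = agree c T' M.
Proof.
move=> fam; apply/andP/forallP => [[/forallP TM /eqP <-] y|T'M].
  apply/implyP => yc; rewrite ffunE; case: ifP => // /eqP ne.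
  by apply: (implyP (TM y)); lia.
split.
  apply/forallP => y; apply/implyP => yc.
  rewrite -(refill_off fam); last by apply/eqP; lia.
  by apply: (implyP (T'M y)); lia.
apply/eqP/ffunP => y; rewrite ffunE; case: ifP => [/eqP yc|/negbT ne].
  by apply/eqP/(implyP (T'M y)); rewrite yc.
by rewrite (refill_off fam).
Qed.

Lemma completions_step c (T : {ffun D -> letter N}) :
  completions (c - 1) T =
  \sum_(T' in family (refill c T) |
          [forall y : D, (content (val y) == c) ==>
                           compat_at T' (val y) (T' y)])
    (\prod_(y : D | content (val y) == c) x c (T' y)) * completions c T'.
Proof.
rewrite /completions (partition_big (merge_at c T) (fun T' =>
  (T' \in family (refill c T)) && [forall y : D, (content (val y) == c) ==>
                           compat_at T' (val y) (T' y)])) /=; last first.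
  move=> M /andP[TM /forallP okM].
  have fam : merge_at c T M \in family (refill c T).
    by apply/familyP => y; rewrite ffunE /refill; case: ifP; rewrite ?inE.
  rewrite fam /=; apply/forallP => y; apply/implyP => /eqP yc.
  by rewrite -(@compat_at_agree c _ M) ?yc // -(agree_merge M fam) TM eqxx.
apply: eq_bigr => T' /andP[fam _]; rewrite mulr_sumr; apply: eq_big => M.
  by rewrite andbAC agree_merge.
move=> /andP[/andP[TM _] MT'].
have /forallP T'M : agree c T' M by rewrite -(agree_merge M fam) TM MT'.
rewrite (bigID (fun y : D => content (val y) == c)) /=; congr (_ * _).
  apply: eq_big => [y|y /andP[_ /eqP yc]].
    by case: eqP => [->|_]; rewrite ?andbF //; lia.
  by rewrite yc; congr (x _ _); apply/eqP/(implyP (T'M y)); rewrite yc.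
apply: eq_bigl => y.
by apply/andP/idP => [[yc /eqP ne]|yc]; [|split; [|apply/eqP]]; lia.
Qed.

(** Both sides satisfy the same recursion, by [det_spread_expand] and
    [completions_step]. *)
Lemma det_sweep_step c (T : {ffun D -> letter N}) :
  (forall T' : {ffun D -> letter N},
     (forall y : D, content (val y) <= c -> compat_at T' (val y) (T' y)) ->
     \det (sweep_mx c T') = completions c T') ->
  (forall y : D, content (val y) <= c - 1 -> compat_at T (val y) (T y)) ->
  \det (sweep_mx (c - 1) T) = completions (c - 1) T.
Proof.
move=> IHc okT.
have okTc (y : D) : content (val y) < c -> compat_at T (val y) (T y).
  by move=> yc; apply: okT; lia.
rewrite det_spread // det_spread_expand // completions_step.
rewrite [RHS]big_mkcondr /=; apply: eq_bigr => T' fam.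
have compatE (y : D) m : content (val y) <= c ->
    compat_at T' (val y) m = compat_at T (val y) m.
  move=> yc; apply: compat_at_eq => z zc; apply: refill_off fam _.
  by apply/eqP; lia.
rewrite big_split /=; case: ifP => [/forallP ok|/forallPn[y]]; last first.
  rewrite negb_imply => /andP[yc /negbTE ny]; rewrite (bigD1 y) //=.
  by rewrite -compatE ?(eqP yc) // ny mul0r !mul0r.
rewrite [X in X * _ * _]big1 ?mul1r => [|y yc]; last first.
  by rewrite -compatE ?(eqP yc) // (implyP (ok y)).
congr (_ * _); apply: IHc => y yc.
have [eqc|/eqP ne] := eqVneq (content (val y)) c.
  by apply: (implyP (ok y)); rewrite eqc.
rewrite compatE // (refill_off fam); last exact/eqP.
by apply: okTc; lia.
Qed.

(** The hypotheses are also met by a ribbon that is its own single strip; then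
    the right-hand side is a one by one determinant. *)
Theorem sum_local_tableaux :
  \sum_(M : {ffun D -> letter N} | local_tableau M)
    \prod_(y : D) x (content (val y)) (M y)
  = \det (\matrix_(i, j) ribbon_sum (p j) (q i)).
Proof.
(* All contents of boxes lie strictly between -b and b. *)
pose b := \sum_k (`|p k|%N + `|q k|%N + 1)%N.
have pqb k : (`|p k| + `|q k| < b)%N.
  by rewrite /b (bigD1 k) //= addn1 ltn_addr.
have sweepP r (T : {ffun D -> letter N}) :
    (forall y : D, content (val y) <= b%:Z - r%:Z -> compat_at T (val y) (T y)) ->
    \det (sweep_mx (b%:Z - r%:Z) T) = completions (b%:Z - r%:Z) T.
  elim: r T => [|r IHr] T okT; last first.
    rewrite (_ : b%:Z - r.+1%:Z = b%:Z - r%:Z - 1); last by lia.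
    by apply: det_sweep_step => // y yc; apply: okT; lia.
  have lt_b (y : D) : content (val y) < b%:Z.
    have := sc_content cov (strip_indexP cov y).
    by have := pqb (strip_index y); lia.
  rewrite subr0; have -> : sweep_mx b T = 1%:M.
    apply/matrixP => i k; rewrite !mxE; have := pqb k => bk.
    have -> : (b%:Z < p k) = false by lia.
    by have -> : (b%:Z <= q k) = false by lia.
  rewrite det1 /completions (big_pred1 T) => [|M].
    by rewrite big_pred0 // => y; have := lt_b y; lia.
  apply/andP/eqP => [[/forallP TM _]|->].
    by apply/ffunP => y; apply/eqP/(implyP (TM y)); have := lt_b y; lia.
  split; first by apply/forallP => y; rewrite eqxx implybT.
  by apply/forallP => y; apply: okT; have := lt_b y; lia.
have gt_b (y : D) : - b%:Z < content (val y).
  have := sc_content cov (strip_indexP cov y).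
  by have := pqb (strip_index y); lia.
pose T0 : {ffun D -> letter N} := [ffun _ => ord0].
have sweep0 : \det (sweep_mx (- b%:Z) T0) = completions (- b%:Z) T0.
  rewrite (_ : - b%:Z = b%:Z - b.*2%:Z); last by lia.
  by apply: sweepP => y; have := gt_b y; lia.
have <- : sweep_mx (- b%:Z) T0 = \matrix_(i, j) ribbon_sum (p j) (q i).
  apply/matrixP => i k; rewrite !mxE.
  by have -> : (- b%:Z < p k) by have := pqb k; lia.
rewrite sweep0; apply: eq_big => [M|M _].
  rewrite (_ : agree _ _ _) //; apply/forallP => y; apply/implyP.
  by have := gt_b y; lia.
by apply: eq_bigl => y; rewrite gt_b.
Qed.

End Sweep.

(** * Skew diagrams and ribbons *)
Lemma mem_diagram la (b : box) :
  (b \in diagram la) =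
  [&& 1 <= b.1, 1 <= b.2 & b.2 <= (nth 0%N la `|b.1|%N.-1)%:Z].
Proof.
case: b => i j; rewrite /diagram in_fset /=.
apply/allpairsPdep/and3P => /= [[k [l [+ + [-> ->]]]]|[i1 j1 jla]].
  by rewrite !mem_iota; case: k => [//|k] /=; split; lia.
exists `|i|%N, `|j|%N; rewrite !mem_iota; split; last by congr pair; lia.
  have [le|lt] := leqP (size la) `|i|%N.-1; last by lia.
  by move: jla; rewrite nth_default; lia.
by lia.
Qed.

Lemma diagram_down la (b x : box) : is_partition la -> b \in diagram la ->
  1 <= x.1 <= b.1 -> 1 <= x.2 <= b.2 -> x \in diagram la.
Proof.
rewrite !mem_diagram => la_part /and3P[b1 b2 bla] /andP[x1 xb1] /andP[x2 xb2].
rewrite x1 x2 /=; apply: le_trans xb2 (le_trans bla _).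
have [le|lt] := leqP (size la) `|b.1|%N.-1; first by rewrite nth_default.
have geqT : transitive geq by move=> k l m /= lk km; apply: leq_trans km lk.
rewrite lez_nat; apply: (sorted_leq_nth geqT leqnn 0%N la_part); rewrite ?inE; lia.
Qed.

Lemma skew_diagram_convex la mu : is_partition la -> is_partition mu ->
  order_convex (skew_diagram la mu).
Proof.
move=> la_part mu_part b x b'; rewrite !in_fsetD => /andP[bmu bla] /andP[_ b'la].
move: (bla); rewrite mem_diagram => /and3P[b1 b2 _] /andP[bx1 xb1] /andP[bx2 xb2].
apply/andP; split; last by apply: (diagram_down la_part b'la); apply/andP; split; lia.
apply: contra bmu => xmu.
by apply: (diagram_down mu_part xmu); apply/andP; split; lia.
Qed.

Section Ribbon.
Variables (d : int -> direction) (p : int).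

Lemma content_ribbon_box k : content (ribbon_box d p k) = p + k%:Z.
Proof.
elim: k => [|k IHk] /=; first by rewrite /content /=; lia.
rewrite (_ : p + k.+1%:Z = content (ribbon_box d p k) + 1); last by rewrite IHk; lia.
by rewrite content_successor.
Qed.

Lemma mem_ribbon q (b : box) :
  reflect (exists2 k, (k <= `|q - p|)%N & b = ribbon_box d p k)
          (b \in ribbon d p q).
Proof.
rewrite in_fset; apply: (iffP mapP) => -[k kq ->]; exists k => //.
  by move: kq; rewrite mem_iota.
by rewrite mem_iota.
Qed.

Lemma ribbon_box_mono k l : (k <= l)%N ->
  (ribbon_box d p l).1 <= (ribbon_box d p k).1 /\
  (ribbon_box d p k).2 <= (ribbon_box d p l).2.
Proof.
move=> /subnK <-; elim: (l - k)%N => [|r [IH1 IH2]]; first by rewrite !lexx.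
rewrite addSn /=; case: (d _) => /=; lia.
Qed.

(** Of two boxes of a ribbon the later one is weakly above and weakly right of
    the earlier one. If it is also weakly below, or the earlier one weakly
    right of it, the two lie in one row or column, and so do the boxes between
    them. *)
Lemma ribbon_convex q : order_convex (ribbon d p q).
Proof.
move=> b x b' /mem_ribbon[k kq bE] /mem_ribbon[l lq bE'] x1 x2.
have ck := content_ribbon_box k; have cl := content_ribbon_box l.
rewrite -bE -bE' in ck cl.
rewrite /content in ck cl.
have [m mE] : exists m : nat, m%:Z = x.2 - x.1 - p.
  exists `|(x.2 - x.1 - p)%R|%N; have [kl|/ltnW lk] := leqP k l.
    by have := ribbon_box_mono kl; rewrite -bE -bE'; lia.
  by have := ribbon_box_mono lk; rewrite -bE -bE'; lia.
have cm := content_ribbon_box m; rewrite /content in cm.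
have [kl|lk] := leqP k l.
  have [r1 r2] := ribbon_box_mono kl; rewrite -bE -bE' in r1 r2.
  have km : (k <= m)%N by lia.
  have ml : (m <= l)%N by lia.
  apply/mem_ribbon; exists m; first by lia.
  have [s1 s2] := ribbon_box_mono km; have [t1 t2] := ribbon_box_mono ml.
  rewrite -bE in s1 s2; rewrite -bE' in t1 t2.
  apply: box_eq; lia.
have [r1 r2] := ribbon_box_mono (ltnW lk); rewrite -bE -bE' in r1 r2.
have mk : (m <= k)%N by lia.
have lm : (l <= m)%N by lia.
apply/mem_ribbon; exists m; first by lia.
have [s1 s2] := ribbon_box_mono mk; have [t1 t2] := ribbon_box_mono lm.
rewrite -bE in s1 s2; rewrite -bE' in t1 t2.
apply: box_eq; lia.
Qed.

Lemma ribbon_strip_cover q : p <= q ->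
  strip_cover (ribbon d p q) (fun _ : 'I_1 => ribbon d p q) d
    (fun _ => p) (fun _ => q).
Proof.
move=> pq; split.
- by move=> b; split=> [bD|[]] //; exists ord0.
- by move=> k l b _ _; rewrite !ord1.
- by move=> _ b /mem_ribbon[k kq ->]; rewrite content_ribbon_box; lia.
- move=> _ b b' /mem_ribbon[k _ ->] /mem_ribbon[l _ ->].
  by rewrite !content_ribbon_box => /addrI[->].
- move=> _; exists (ribbon_box d p `|q - p|%N).
    by apply/mem_ribbon; exists `|q - p|%N.
  by rewrite content_ribbon_box; lia.
- move=> _ b /mem_ribbon[[|k] kq ->]; rewrite content_ribbon_box.
    by rewrite addr0 eqxx.
  move=> _; apply/mem_ribbon; exists k; first by lia.
  by rewrite /= successorK.
move=> _ b bE cb; apply/mem_ribbon => -[k _ /(congr1 content)].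
rewrite content_predecessor content_ribbon_box cb; lia.
Qed.

End Ribbon.

Lemma head_filterP (T : eqType) (x0 : T) (P : pred T) (s : seq T) :
  head x0 (filter P s) != x0 -> P (head x0 (filter P s)).
Proof.
case: (filter P s) (filter_all P s) => /= [_|y s' /andP[] //].
by rewrite eqxx.
Qed.

(** Every box of a strip other than the starting box has its predecessor in
    the strip, so walking back from a box reaches the starting box by a path
    that depends only on [d]; hence a strip has at most one box of each
    content. *)
Lemma outside_strip_cover la mu n (theta : 'I_n -> {fset box}) d :
  let D := skew_diagram la mu in
  outside_decomposition D theta -> compatible_directions D theta d ->
  strip_cover D theta d (fun k => content (start_box (theta k)))
    (fun k => content (end_box (theta k))).
Proof.
move=> D [_ disj cov onl onr] [appr strt].
(* The start and end boxes are genuine because they lie in D, which does not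
   contain the default box (0, 0). *)
have nz b : b \in D -> b != (0, 0).
  rewrite in_fsetD => /andP[_]; rewrite mem_diagram => /and3P[b1 _ _].
  by apply: contraTneq b1 => ->.
have startP k : is_start (theta k) (start_box (theta k)).
  by apply: head_filterP; apply: nz; case/orP: (onl k) => /andP[].
have endP k : is_end (theta k) (end_box (theta k)).
  by apply: head_filterP; apply: nz; case/orP: (onr k) => /andP[].
have ge_start k b : b \in theta k -> content (start_box (theta k)) <= content b.
  move=> bk; have /andP[_ /allP/(_ b bk)] := startP k.
  by rewrite /content; lia.
have le_end k b : b \in theta k -> content b <= content (end_box (theta k)).
  move=> bk; have /andP[_ /allP/(_ b bk)] := endP k.
  by rewrite /content; lia.
have eq_start k b : b \in theta k ->
    content b = content (start_box (theta k)) -> b = start_box (theta k).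
  move=> bk bc; apply/eqP; apply: contraT => /(appr k b bk) /ge_start.
  by rewrite content_predecessor; lia.
split.
- exact: cov.
- move=> k l b bk bl; apply/eqP; apply: contraT => /disj /fdisjointP /(_ b bk).
  by rewrite bl.
- by move=> k b bk; rewrite ge_start ?le_end.
- move=> k b b' bk b'k eqc.
  have [r] : exists r : nat, content b = content (start_box (theta k)) + r%:Z.
    exists `|(content b - content (start_box (theta k)))%R|%N.
    by have := ge_start k b bk; lia.
  elim: r b bk b' b'k eqc => [|r IHr] b bk b' b'k eqc cb.
    have cs : content b = content (start_box (theta k)) by lia.
    by rewrite (eq_start k b bk cs) (eq_start k b' b'k) // -eqc.
  have ns b0 : content b0 = content b -> b0 != start_box (theta k).
    by move=> eqb; apply/eqP => b0s; move: eqb; rewrite b0s; lia.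
  have pb := appr k b bk (ns b erefl); have pb' := appr k b' b'k (ns b' (esym eqc)).
  have := IHr _ pb _ pb'; rewrite !content_predecessor -eqc => /(_ erefl).
  by rewrite cb => /(_ ltac:(lia)) /predecessor_inj.
- by move=> k; exists (end_box (theta k)) => //; case/andP: (endP k).
- by move=> k b bk ne; apply: appr => //; apply: contra_neq ne => ->.
move=> k b bk /(eq_start k b bk) ->; have /= := strt k.
by case: (d _) => /andP[].
Qed.

(** * Orthogonal functions as sums with local conditions *)
Section Zeta.
Variables (R : realType) (N : nat) (a : int -> R[i]).

Definition zeta_weight (c : int) (m : letter N) : R[i] :=
  if flag_ok c m then complex_pow (letter_abs R m) (- a c) else 0.

Lemma so_zeta_local (E : {fset box}) (s : E -> R[i]) :
  order_convex E -> (forall y, s y = a (content (val y))) ->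
  so_zeta N s = \sum_(M : {ffun E -> letter N} | local_tableau M)
                  \prod_(y : E) zeta_weight (content (val y)) (M y).
Proof.
move=> convE sE; rewrite /so_zeta; under eq_bigl do rewrite so_tableauE //.
rewrite big_mkcondr /=; apply: eq_bigr => M _; case: ifPn => [/forallP ok|].
  by apply: eq_bigr => y _; rewrite /zeta_weight ok sE.
move=> /forallPn[y /negbTE ny].
by rewrite (bigD1 y) //= /zeta_weight ny mul0r.
Qed.

Lemma so_zeta_ribbon d p q : p <= q ->
  so_zeta N (diag_filling a (E := ribbon d p q))
  = ribbon_sum zeta_weight d p q.
Proof.
move=> pq; rewrite so_zeta_local //; last exact: ribbon_convex.
rewrite (sum_local_tableaux _ (@ribbon_convex d p q) (ribbon_strip_cover d pq)).
by rewrite det_mx11 mxE.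
Qed.

Lemma hash_entryE d (ti tj : {fset box}) :
  hash_entry N a (hash d ti tj)
  = ribbon_sum zeta_weight d (content (start_box tj)) (content (end_box ti)).
Proof.
rewrite /hash; set p := content _; set q := content _.
case: lerP => [pq|qp] /=.
  rewrite so_zeta_ribbon // ifF //; apply/negbTE/fset0Pn.
  by exists (ribbon_box d p 0); apply/mem_ribbon; exists 0%N.
rewrite /ribbon_sum big1 => [|m _]; last by rewrite /tail leNgt qp mulr0.
rewrite add0r; case: eqP => [->|pq] /=; first by rewrite addrK eqxx.
by case: eqP => // qE; case: pq; rewrite qE subrK.
Qed.

End Zeta.

Theorem theorem8p4 (R : realType) (la mu : seq nat) (N : nat)
    (a : int -> R[i]) (s : skew_diagram la mu -> R[i])
    (n : nat) (theta : 'I_n -> {fset box}) (d : int -> direction)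
    (la_part : is_partition la) (mu_part : is_partition mu)
    (mu_la : diagram mu `<=` diagram la)
    (N_gt0 : (0 < N)%N)
    (s_diag : forall x : skew_diagram la mu, s x = a (content (val x)))
    (theta_outside : outside_decomposition (skew_diagram la mu) theta)
    (d_compatible : compatible_directions (skew_diagram la mu) theta d) :
  so_zeta N s
  = \det (\matrix_(i < n, j < n) hash_entry N a (hash d (theta i) (theta j))).
Proof.
have convD := skew_diagram_convex la_part mu_part.
rewrite (so_zeta_local _ convD s_diag).
rewrite (sum_local_tableaux _ convD
  (outside_strip_cover theta_outside d_compatible)).
by congr (\det _); apply/matrixP => i j; rewrite !mxE hash_entryE.
Qed.
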